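(* For every integer $k\geq 3$, $$\operatorname{gr}_k(P_5:S_4^1)= \begin{cases} 17, & k=3;\\ 6, & k=4;\\ 5, & k=5,6;\\ \ell, & \binom{\ell-1}{2}+1\leq k\leq \binom{\ell}{2}\ \text{ for an integer } \ell\geq 5. \end{cases}$$
   Context: All graphs are finite, simple and undirected. $K_n$ is the complete graph on $n$ vertices and $P_5$ is the path with $5$ vertices and $4$ edges. $S_t^r$ is the graph of order $t$ obtained from the star $K_{1,t-1}$ by adding $r$ pairwise independent edges between the leaves; thus $S_4^1$ is a triangle with one pendent edge attached. A $k$-edge-coloring assigns to each edge one of $k$ colors; all $k$-edge-colorings are assumed exact, i.e. each of the $k$ colors is used at least once. An edge-colored graph is rainbow if all its edges have different colors and monochromatic if all its edges have a single color. A copy of a graph means a (not necessarily induced) subgraph isomorphic to it. For non-empty graphs $G,H$ (graphs with at least one edge) and a positive integer $k$, the Gallai-Ramsey number $\operatorname{gr}_k(G:H)$ is the minimum integer $N$ with $\binom{N}{2}\geq k$ (so that $K_N$ admits a $k$-edge-coloring) such that for all $n\geq N$, every $k$-edge-coloring of $K_n$ contains either a rainbow copy of $G$ or a monochromatic copy of $H$. *)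

(* Defs.v *)
From HB Require Import structures.
From mathcomp Require Import all_boot.

Set Implicit Arguments.
Unset Strict Implicit.
Unset Printing Implicit Defensive.

Record sgraph := SGraph {
  vertex :> finType;
  adj : rel vertex;
  adj_sym : symmetric adj;
  adj_irrefl : irreflexive adj
}.

Section SymGraph.

Variables (T : finType) (a : rel T).

Definition sym_adj : rel T := fun x y => (x != y) && (a x y || a y x).

Lemma sym_adj_sym : symmetric sym_adj.
Proof. by move=> x y; rewrite /sym_adj eq_sym orbC. Qed.

Lemma sym_adj_irrefl : irreflexive sym_adj.
Proof. by move=> x; rewrite /sym_adj eqxx. Qed.

Definition sym_graph : sgraph := SGraph sym_adj_sym sym_adj_irrefl.

End SymGraph.

Definition complete_graph (n : nat) : sgraph :=
  sym_graph (fun _ _ : 'I_n => true).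

(* The path with n vertices (not n edges). *)
Definition path_graph (n : nat) : sgraph :=
  sym_graph (fun i j : 'I_n => i.+1 == j).

(* The graph S_t^r, for 2 r <= t - 1: vertex 0 is the center of the star, and
   the r added independent edges are {1, 2}, {3, 4}, ..., {2 r - 1, 2 r}. *)
Definition star_plus (t r : nat) : sgraph :=
  sym_graph (fun i j : 'I_t =>
    (i == 0 :> nat) || [&& odd i, j == i.+1 :> nat & j <= r.*2]).

Definition edges (G : sgraph) : {set {set G}} :=
  [set [set p.1; p.2] | p : G * G & adj p.1 p.2].

(* F is the edge set of a (not necessarily induced) subgraph of G that is
   isomorphic to H. *)
Definition is_copy (H G : sgraph) (F : {set {set G}}) : Prop :=
  exists f : H -> G,
    [/\ injective f,
        forall x y : H, adj x y -> adj (f x) (f y)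
      & F = [set f @: e | e : {set H} in edges H]].

(* Edge colorings are functions on all vertex subsets; only the values on the
   edges are ever used. *)
Definition exact_coloring (k : nat) (G : sgraph) (c : {set G} -> 'I_k) : Prop :=
  forall i : 'I_k, exists2 e, e \in edges G & c e = i.

Definition rainbow (k : nat) (G : sgraph) (c : {set G} -> 'I_k)
    (F : {set {set G}}) : Prop :=
  {in F &, injective c}.

Definition monochromatic (k : nat) (G : sgraph) (c : {set G} -> 'I_k)
    (F : {set {set G}}) : Prop :=
  exists i : 'I_k, forall e, e \in F -> c e = i.

Definition forces (k : nat) (G H : sgraph) (n : nat) : Prop :=
  forall c : {set complete_graph n} -> 'I_k, exact_coloring c ->
    (exists2 F, is_copy G F & rainbow c F) \/
    (exists2 F, is_copy H F & monochromatic c F).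

Definition gr_bound (k : nat) (G H : sgraph) (N : nat) : Prop :=
  k <= 'C(N, 2) /\ forall n : nat, N <= n -> forces k G H n.

(* gr_k(G : H) = N. *)
Definition is_gallai_ramsey (k : nat) (G H : sgraph) (N : nat) : Prop :=
  gr_bound k G H N /\ forall M : nat, gr_bound k G H M -> N <= M.

(* Main.v *)
(* With three colors a rainbow P_5 is impossible, and a color class without a paw
   is triangle-free outside isolated triangles; this runs the classical argument
   for R(3, 3, 3) = 17.

   With at least four colors, call a color private to a vertex v of W if all its
   edges inside W pass through v. A color is private to at most two vertices, so
   if W has at least six vertices and every vertex removal leaves at most three
   colors, counting gives |W| = 6 and four colors, three of which form a perfect
   matching; the fourth then contains a paw. Hence one can descend to five
   vertices spanning four colors, and an exhaustive search on five or six
   vertices, with colorings taken up to renaming of colors, finishes. *)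
Require Import Defs.
From mathcomp Require Import all_boot.

Set Implicit Arguments.
Unset Strict Implicit.
Unset Printing Implicit Defensive.

(** * Paths and paws for colorings given as functions of two vertices *)

Definition path_colors (V C : Type) (col : V -> V -> C) (p : seq V) : seq C :=
  if p is x :: q then pairmap col x q else [::].

Definition paw_colors (V C : Type) (col : V -> V -> C) (x y z w : V) : seq C :=
  [:: col x y; col x z; col y z; col x w].

Definition rainbow_P5_free (V C : eqType) (col : V -> V -> C) : Prop :=
  forall p, uniq p -> size p = 5 -> ~~ uniq (path_colors col p).

Definition mono_paw_free (V C : eqType) (col : V -> V -> C) : Prop :=
  forall x y z w, uniq [:: x; y; z; w] -> ~~ constant (paw_colors col x y z w).

(** * Exhaustive search on five and six vertices *)

Section Search.

Implicit Types (n r : nat) (s : seq nat) (p : seq nat).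

Fixpoint injective_seqs n m : seq (seq nat) :=
  if m is m'.+1 then
    flatten [seq [seq x :: p | x <- iota 0 n & x \notin p]
            | p <- injective_seqs n m']
  else [:: [::]].

Lemma mem_injective_seqs n m p :
  (p \in injective_seqs n m) = [&& uniq p, size p == m & all (fun x => x < n) p].
Proof.
elim: m p => [|m IHm] [|x p] //=; first by rewrite andbF.
  by apply/flattenP=> -[? /mapP[q _ ->] /mapP[]].
rewrite eqSS; apply/flattenP/and3P => [[? /mapP[q + ->] /mapP[y]]|].
  rewrite IHm mem_filter mem_iota /= => /and3P[q_uniq q_size q_lt] /andP[yq y_lt].
  by case=> -> ->; rewrite yq q_uniq q_size y_lt q_lt.
case=> /andP[xp p_uniq] p_size /andP[x_lt p_lt].
exists [seq y :: p | y <- iota 0 n & y \notin p].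
  by apply: (map_f (fun p => _)); rewrite IHm p_uniq p_size.
by apply: (map_f (cons^~ p)); rewrite mem_filter mem_iota xp.
Qed.

(* Position of the edge {u, v} in the list 01, 02, 12, 03, 13, 23, ..., in which
   the edges inside the first n vertices come first. *)
Definition edge_index (u v : nat) : nat := 'C(maxn u v, 2) + minn u v.

Definition edge_list n : seq (nat * nat) :=
  [seq (u, v) | v <- iota 0 n, u <- iota 0 v].

(** A boolean check, so that for [n = 5] and [n = 6] evaluation replaces an argument about binomial
    coefficients. *)
Definition edge_index_valid n : bool :=
  (take 10 (edge_list n) == edge_list 5) &&
  all (fun u => all (fun v => (u != v) ==>
    (edge_index u v < size (edge_list n)) &&
    (nth (0, 0) (edge_list n) (edge_index u v) == (minn u v, maxn u v)))
    (iota 0 n)) (iota 0 n).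

Lemma edge_indexP n u v : edge_index_valid n -> u < n -> v < n -> u != v ->
  edge_index u v < size (edge_list n) /\
  nth (0, 0) (edge_list n) (edge_index u v) = (minn u v, maxn u v).
Proof.
case/andP=> _ /allP valid u_lt v_lt uv.
have /allP/(_ v) := valid u ltac:(by rewrite mem_iota).
by rewrite mem_iota uv => /(_ v_lt)/andP[-> /eqP].
Qed.

Definition last_index (e : seq nat) : nat := foldr maxn 0 e.

Lemma leq_last_index (e : seq nat) i : i \in e -> i <= last_index e.
Proof.
elim: e => //= j e IHe; rewrite inE leq_max => /orP[/eqP->|/IHe ->].
  by rewrite leqnn.
by rewrite orbT.
Qed.

Definition paw_indices (p : seq nat) : seq nat :=
  if p is [:: x; y; z; w] then paw_colors edge_index x y z w else [::].

(* A coloring of an initial segment of the edge list is represented by the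
   sequence sending each edge to the first edge of the same color. The test for
   edge i only looks at the paths and paws completed by that edge; r is the
   number of colors required on the first five vertices. *)
Definition edge_test n r (i : nat) : pred (seq nat) :=
  let P := [seq e <- [seq path_colors edge_index p | p <- injective_seqs n 5]
           | last_index e == i] in
  let Q := [seq e <- [seq paw_indices p | p <- injective_seqs n 4]
           | last_index e == i] in
  fun s => [&& (i == 9) ==> (r <= size (undup s)),
    all (fun e => ~~ uniq [seq nth 0 s j | j <- e]) P
  & all (fun e => ~~ constant [seq nth 0 s j | j <- e]) Q].

(** Backtracking: the next edge either opens a new color class, labelled by its own position
    [size s], or repeats a label. Under call-by-value the [if] prunes the subtree below a failed
    test; a branch that outlasts all tests makes the answer [false]. *)
Fixpoint refuted (tests : seq (pred (seq nat))) s : bool :=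
  if tests is t :: tests' then
    all (fun x => let s' := rcons s x in if t s' then refuted tests' s'
                                         else true)
        (size s :: undup s)
  else false.

Definition no_good_coloring n r : bool :=
  refuted [seq edge_test n r i | i <- iota 0 (size (edge_list n))] [::].

(** The threshold 5 cannot be lowered on five vertices: [not_forces4] exhibits a good coloring with
    four colors. *)
Lemma no_good_coloring5 : no_good_coloring 5 5.
Proof. by vm_compute. Qed.

Lemma no_good_coloring6 : no_good_coloring 6 4.
Proof. by vm_compute. Qed.


End Search.

(** * Soundness of the search *)

Section Soundness.

Variables (T : eqType) (x0 : T).

Definition canon_at (L s : seq T) : seq nat := [seq index x L | x <- s].

Definition canon (L : seq T) : seq nat := canon_at L L.

Lemma nth_canon (L : seq T) i : i < size L ->
  nth 0 (canon L) i = index (nth x0 L i) L.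
Proof. by move=> iL; rewrite (nth_map x0). Qed.

(** The first edge of a color is labelled by its own position, so a label smaller than [i] already
    occurs at the position it names. Hence [refuted] tries every label that can come next. *)
Lemma canon_step (L : seq T) i : i < size L ->
  nth 0 (canon L) i \in i :: take i (canon L).
Proof.
move=> iL; rewrite nth_canon // inE.
have le_i : index (nth x0 L i) L <= i.
  by rewrite leqNgt; apply/negP=> /(before_find x0) /=; rewrite eqxx.
case: (ltngtP (index (nth x0 L i) L) i) le_i => // lt_i _.
apply/orP; right; apply/(nthP 0).
exists (index (nth x0 L i) L); first by rewrite size_takel // size_map ltnW.
by rewrite nth_take // nth_canon ?nth_index ?mem_nth // index_mem mem_nth.
Qed.

(** The prefixes of [canon L] trace one branch of the search; if all tests hold along it, that
    branch survives to the end. *)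
Lemma refutedP (L : seq T) (tests : seq (pred (seq nat))) i :
  i + size tests = size L ->
  (forall j, j < size tests -> nth xpredT tests j (take (i + j).+1 (canon L))) ->
  ~~ refuted tests (take i (canon L)).
Proof.
elim: tests i => [|t tests IH] i //= def_size testP.
have iL : i < size L by rewrite -def_size addnS ltnS leq_addr.
have size_c : size (canon L) = size L by rewrite size_map.
have take_i : rcons (take i (canon L)) (nth 0 (canon L) i) = take i.+1 (canon L).
  by rewrite (take_nth 0) ?size_c.
rewrite size_takel ?size_c 1?ltnW //; apply/negP=> /andP[hi /allP hs].
have nt : ~~ refuted tests (take i.+1 (canon L)).
  apply: IH => [|j lt_j]; first by rewrite addSnnS.
  by have := testP j.+1 lt_j; rewrite addSnnS.
have t0 : t (take i.+1 (canon L)) by have := testP 0 isT; rewrite addn0.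
have := canon_step iL; rewrite inE => /orP[/eqP e|].
  by rewrite e in take_i; move: hi; rewrite take_i t0 (negPf nt).
by rewrite -mem_undup => /hs; rewrite take_i t0 (negPf nt).
Qed.

Lemma map_nth_take_canon (L : seq T) (e : seq nat) :
  all (fun i => i < size L) e ->
  [seq nth 0 (take (last_index e).+1 (canon L)) i | i <- e]
  = canon_at L [seq nth x0 L i | i <- e].
Proof.
move=> /allP e_lt; rewrite /canon_at -map_comp; apply/eq_in_map => i ie /=.
by rewrite nth_take ?ltnS ?leq_last_index // nth_canon ?e_lt.
Qed.

Lemma canon_at_uniq (L s : seq T) : uniq (canon_at L s) -> uniq s.
Proof. exact: map_uniq. Qed.

Lemma canon_at_constant (L s : seq T) :
  {subset s <= L} -> constant (canon_at L s) -> constant s.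
Proof.
case: s => //= x s sub; rewrite all_map => /allP h; apply/allP=> y ys.
have /eqP/(congr1 (nth x0 L)) := h y ys.
by rewrite /= !nth_index ?sub ?mem_head // ?inE ?ys ?orbT // => ->.
Qed.

Lemma good_coloring_search n r (col : nat -> nat -> T) :
  edge_index_valid n ->
  (forall u v, col u v = col v u) ->
  (forall p, all (fun u => u < n) p -> uniq p -> size p = 5 ->
     ~~ uniq (path_colors col p)) ->
  (forall x y z w, all (fun u => u < n) [:: x; y; z; w] ->
     uniq [:: x; y; z; w] -> ~~ constant (paw_colors col x y z w)) ->
  r <= size (undup [seq col e.1 e.2 | e <- edge_list 5]) ->
  ~~ no_good_coloring n r.
Proof.
move=> valid col_sym path_free paw_free r_le.
set L := [seq col e.1 e.2 | e <- edge_list n].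
have nthL u v : u < n -> v < n -> u != v ->
  edge_index u v < size L /\ nth x0 L (edge_index u v) = col u v.
  move=> u_lt v_lt uv; have [lt_s nthE] := edge_indexP valid u_lt v_lt uv.
  rewrite size_map; split=> //; rewrite (nth_map (0, 0)) // nthE /=.
  by case: leqP => // _; rewrite col_sym.
rewrite /no_good_coloring -(take0 (canon L)); apply: refutedP => [|j].
  by rewrite !size_map size_iota.
rewrite size_map size_iota add0n => j_lt.
rewrite (nth_map 0) ?size_iota // nth_iota // add0n.
apply/and3P; split.
(* Edge 9 is the last of the ten edges inside the first five vertices, so the prefix tested here
   covers exactly [edge_list 5]. *)
- apply/implyP=> /eqP->; apply: leq_trans r_le _.
  have -> : [seq col e.1 e.2 | e <- edge_list 5] = take 10 L.
    by case/andP: valid => /eqP<- _; rewrite map_take.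
  rewrite -(size_map (nth x0 L)); apply: uniq_leq_size (undup_uniq _) _ => x.
  rewrite mem_undup => xL; apply/mapP; exists (index x L).
    by rewrite mem_undup -map_take (map_f (index^~ L)).
  by rewrite nth_index // (mem_take xL).
- apply/allP=> e; rewrite mem_filter => /andP[/eqP<- /mapP[p]].
  rewrite mem_injective_seqs => /and3P[p_uniq /eqP p_size p_lt] def_e.
  have [e_lt mapE] : all (fun i => i < size L) e /\
      [seq nth x0 L i | i <- e] = path_colors col p.
    move: p_size p_lt p_uniq; rewrite {}def_e.
    case: p => [|a [|b [|c [|d [|f []]]]]] //= _.
    rewrite !inE !negb_or => /and5P[a_lt b_lt c_lt d_lt /andP[f_lt _]].
    case/and5P=> /andP[ab _] /andP[bc _] /andP[cd _] df _.
    have [-> ->] := nthL a b a_lt b_lt ab.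
    have [-> ->] := nthL b c b_lt c_lt bc.
    have [-> ->] := nthL c d c_lt d_lt cd.
    by have [-> ->] := nthL d f d_lt f_lt df.
  rewrite map_nth_take_canon //; apply/negP=> /canon_at_uniq.
  by rewrite mapE; apply/negP/path_free.
- apply/allP=> e; rewrite mem_filter => /andP[/eqP<- /mapP[p]].
  rewrite mem_injective_seqs => /and3P[p_uniq /eqP p_size p_lt] def_e.
  move: p_size p_lt p_uniq def_e; case: p => [|x [|y [|z [|w []]]]] // _.
  move=> p_lt p_uniq def_e; rewrite /= in def_e.
  have [e_lt mapE] : all (fun i => i < size L) e /\
      [seq nth x0 L i | i <- e] = paw_colors col x y z w.
    move: p_lt p_uniq; rewrite {}def_e /= !inE !negb_or.
    case/and5P=> x_lt y_lt z_lt w_lt _ /and4P[/and3P[xy xz xw] /andP[yz _] _ _].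
    have [-> ->] := nthL x y x_lt y_lt xy.
    have [-> ->] := nthL x z x_lt z_lt xz.
    have [-> ->] := nthL y z y_lt z_lt yz.
    by have [-> ->] := nthL x w x_lt w_lt xw.
  rewrite map_nth_take_canon //; apply/negP=> /canon_at_constant h.
  suff: constant (paw_colors col x y z w) by apply/negP/paw_free.
  rewrite -mapE; apply: h => ? /mapP[i ie ->].
  by rewrite mem_nth // (allP e_lt).
Qed.

End Soundness.

(** * Four or more colors *)

Section ManyColors.

Variables (V C : finType) (col : V -> V -> C).
Hypothesis col_sym : forall x y, col x y = col y x.

Definition colors_on (W : {set V}) : {set C} :=
  [set col e.1 e.2 | e : V * V & [&& e.1 \in W, e.2 \in W & e.1 != e.2]].

Lemma colors_onP (W : {set V}) i :
  reflect (exists x y, [/\ x \in W, y \in W, x != y & i = col x y])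
          (i \in colors_on W).
Proof.
apply: (iffP imsetP) => [[[x y]]|[x [y [xW yW xy ->]]]].
  by rewrite inE /= => /and3P[xW yW xy] ->; exists x, y.
by exists (x, y); rewrite // inE xW yW.
Qed.

Lemma mem_colors_on (W : {set V}) x y :
  x \in W -> y \in W -> x != y -> col x y \in colors_on W.
Proof. by move=> xW yW xy; apply/colors_onP; exists x, y. Qed.

Lemma path_colors_map (T : Type) (f : T -> V) (p : seq T) :
  path_colors col (map f p) = path_colors (fun x y => col (f x) (f y)) p.
Proof. by case: p => //= x p; elim: p x => //= y p IHp x; rewrite IHp. Qed.

Hypothesis paw_free : mono_paw_free col.

Lemma paw_freeP x y z w j : uniq [:: x; y; z; w] ->
  col x y = j -> col x z = j -> col y z = j -> col x w = j -> False.
Proof.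
by move=> /paw_free /= /negP nc xy xz yz xw; apply: nc; rewrite xy xz yz xw eqxx.
Qed.

Lemma exists_in_setD (W A : {set V}) : #|A| < #|W| ->
  exists2 x, x \in W & x \notin A.
Proof.
move=> ltAW; have : ~~ (W \subset A).
  by apply/negP=> /subset_leq_card; rewrite leqNgt ltAW.
by case/subsetPn=> x; exists x.
Qed.

(** The paw is picked greedily: each new vertex avoids those already chosen and the exceptional
    neighbors of the ones it is joined to. These are at most four vertices, while [W] has at least
    six. *)
Lemma mono_paw_near_complete (W : {set V}) j : 5 < #|W| ->
  (forall v, v \in W -> #|[set u in W | (u != v) && (col v u != j)]| <= 1) ->
  False.
Proof.
set N := fun v => [set u in W | (u != v) && (col v u != j)] => W_gt N_le.
have colN u v : v \in W -> v \notin N u -> v != u -> col u v = j.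
  by move=> vW vN vu; apply/eqP; move: vN; rewrite inE vW vu /= negbK.
have [|x xW _] := @exists_in_setD W set0; first by rewrite cards0 (leq_trans _ W_gt).
have Nx := N_le x xW.
have [|y yW] := @exists_in_setD W (x |: N x).
  rewrite cardsU1; apply: leq_ltn_trans (leq_add (leq_b1 _) Nx) _.
  exact: leq_trans W_gt.
rewrite in_setU1 negb_or => /andP[yx yNx].
have Ny := N_le y yW.
have cardU (A B : {set V}) : #|A :|: B| <= #|A| + #|B|.
  by rewrite cardsU leq_subr.
have [|z zW] := @exists_in_setD W ([set x; y] :|: (N x :|: N y)).
  apply: leq_ltn_trans (cardU _ _) _.
  apply: leq_ltn_trans (leq_add (leqnn _) (leq_trans (cardU _ _) (leq_add Nx Ny))) _.
  by rewrite cards2; apply: leq_trans W_gt; case: (x != y).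
rewrite in_setU negb_or => /andP[]; rewrite in_set2 negb_or => /andP[zx zy].
rewrite in_setU negb_or => /andP[zNx zNy].
have [|w wW] := @exists_in_setD W ([set x; y; z] :|: N x).
  apply: leq_ltn_trans (cardU _ _) _.
  apply: leq_ltn_trans (leq_add (cardU _ _) Nx) _.
  by rewrite cards1 cards2; apply: leq_trans W_gt; case: (x != y).
rewrite in_setU negb_or => /andP[]; rewrite !in_setU !in_set1 !negb_or.
case/andP=> /andP[wx wy] wz wNx.
apply: (@paw_freeP x y z w j).
- rewrite /= !inE !negb_or (eq_sym x y) (eq_sym x z) (eq_sym x w) (eq_sym y z).
  by rewrite (eq_sym y w) (eq_sym z w) yx zx wx zy wy wz.
- by apply: colN; rewrite // eq_sym.
- by apply: colN; rewrite // eq_sym.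
- by apply: colN; rewrite // eq_sym.
- by apply: colN; rewrite // eq_sym.
Qed.

(* A color is private to v in W if all its edges inside W pass through v. *)
Lemma drop_vertex (W : {set V}) : 5 < #|W| -> 3 < #|colors_on W| ->
  exists2 v, v \in W & 3 < #|colors_on (W :\ v)|.
Proof.
move=> W_gt S_gt; set S := colors_on W.
case: (boolP [exists v in W, 3 < #|colors_on (W :\ v)|]) => [/exists_inP //|].
rewrite negb_exists_in => /forall_inP few; exfalso.
pose priv v := S :\: colors_on (W :\ v).
pose sup i := [set v in W | i \in priv v].
have priv_ge v : v \in W -> #|S| <= 3 + #|priv v|.
  move=> vW; rewrite -(cardsID (colors_on (W :\ v)) S) leq_add2r.
  apply: leq_trans (subset_leq_card (subsetIr _ _)) _.
  by rewrite leqNgt few.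
(* Removing a vertex other than [x] and [y] keeps the edge between them, so its color can be private
   to these two only. *)
have sup_sub x y : x \in W -> y \in W -> x != y ->
    sup (col x y) \subset [set x; y].
  move=> xW yW xy; apply/subsetP=> v; rewrite !inE => /and3P[vW nS _].
  apply: contraR nS; rewrite negb_or => /andP[vx vy].
  by rewrite mem_colors_on // !inE ?xW ?yW ?andbT // eq_sym.
have sup_le i : i \in S -> #|sup i| <= 2.
  case/colors_onP=> x [y [xW yW xy ->]].
  by apply: leq_trans (subset_leq_card (sup_sub x y xW yW xy)) _; rewrite cards2 xy.
have double_count : \sum_(v in W) #|priv v| = \sum_(i in S) #|sup i|.
  transitivity (\sum_(v in W) \sum_(i in S) (i \in priv v : nat)).
    apply: eq_bigr => v vW; rewrite -sum1_card [RHS]big_mkcond /= big_mkcond /=.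
    by apply: eq_bigr => i _; rewrite inE; case: (i \in S); rewrite ?andbF //; case: ifP.
  rewrite exchange_big; apply: eq_bigr => i iS.
  rewrite -sum1_card big_mkcond [RHS]big_mkcond /=.
  by apply: eq_bigr => v _; rewrite !inE; case: (v \in W) => //=; case: (_ && _).
(* Each vertex has at least [#|S| - 3] private colors, and each color is private to at most two
   vertices. As [#|W| >= 6], this gives [6 * (#|S| - 3) <= 2 * #|S|], hence [#|S| <= 4]. *)
have S4 : #|S| = 4.
  have le1 : #|W| * (#|S| - 3) <= \sum_(v in W) #|priv v|.
    by rewrite -sum_nat_const; apply: leq_sum => v vW; rewrite leq_subLR priv_ge.
  have le2 : \sum_(i in S) #|sup i| <= #|S| * 2.
    by rewrite -sum_nat_const; apply: leq_sum.
  have {le1 le2} := leq_trans le1 (leq_trans (eq_leq double_count) le2).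
  have -> : #|S| = (#|S| - 4).+4 by rewrite -[LHS](subnK S_gt) addn4.
  case: (#|S| - 4) => // m; rewrite subSS subSS subSS subn0 => le; exfalso.
  have {le} := leq_trans (leq_mul W_gt (leqnn _)) le.
  apply/negP; rewrite -ltnNge -[m.+1.+4]/(5 + m) -[m.+2]/(2 + m) mulnDl mulnDr.
  by rewrite -addSn leq_add // (mulnC m) leq_mul2r orbT.
(* Otherwise each of the four colors is private to a chosen vertex [r i], and two vertices [x], [y]
   of [W] are not chosen. But the vertex chosen for the color of their edge must be [x] or [y]. *)
have [j jS sup0] : exists2 j, j \in S & sup j = set0.
  case: (boolP [exists j in S, sup j == set0]) => [/exists_inP[j jS /eqP]|].
    by exists j.
  rewrite negb_exists_in => /forall_inP sup_n0; exfalso.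
  have [x0 _] : exists2 x, x \in W & x \notin set0.
    by apply: exists_in_setD; rewrite cards0 (leq_trans _ W_gt).
  pose r i := odflt x0 [pick v in sup i].
  have rP i : i \in S -> r i \in sup i.
    move=> iS; rewrite /r; case: pickP => // none.
    by case/set0Pn: (sup_n0 i iS) => v; rewrite none.
  have R_le : #|r @: S| <= 4 by rewrite -S4 leq_imset_card.
  have [x xW xR] : exists2 x, x \in W & x \notin r @: S.
    by apply: exists_in_setD; apply: leq_ltn_trans R_le (ltnW W_gt).
  have [y yW] : exists2 y, y \in W & y \notin x |: r @: S.
    by apply: exists_in_setD; rewrite cardsU1 xR; apply: leq_ltn_trans W_gt.
  rewrite !inE negb_or => /andP[yx yR].
  have cS : col x y \in S by rewrite mem_colors_on // eq_sym.
  have := subsetP (sup_sub x y xW yW _) _ (rP _ cS); rewrite eq_sym yx => /(_ isT).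
  rewrite in_set2 => /orP[]/eqP e; [case/negP: xR | case/negP: yR].
    by rewrite -e imset_f.
  by rewrite -e imset_f.
have S'3 : #|S :\ j| = 3 by have := cardsD1 j S; rewrite jS S4 => -[].
have sum_S' : \sum_(v in W) #|priv v| = \sum_(i in S :\ j) #|sup i|.
  rewrite double_count (big_setD1 j) //= sup0 cards0 add0n.
  by [].
have priv_pos v : v \in W -> 0 < #|priv v|.
  by move=> vW; have := priv_ge v vW; rewrite S4 -{1}[4]/(3 + 1) leq_add2l.
have sup_le' i : i \in S :\ j -> #|sup i| <= 2.
  by case/setD1P=> _; apply: sup_le.
have sum_ge : 6 <= \sum_(v in W) #|priv v|.
  by apply: leq_trans W_gt _; rewrite -sum1_card; apply: leq_sum.
(* The sets [sup i] of the three colors other than [j] have total size at least six. Two of them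
   account for at most four, so the remaining one has both endpoints. *)
have sup_eq x y : x \in W -> y \in W -> x != y -> col x y != j ->
    sup (col x y) = [set x; y].
  move=> xW yW xy nj; apply/eqP; rewrite eqEcard sup_sub // cards2 xy.
  have cS : col x y \in S :\ j by rewrite !inE nj mem_colors_on.
  move: sum_ge; rewrite sum_S' (big_setD1 _ cS) /=.
  have le4 : \sum_(i in (S :\ j) :\ col x y) #|sup i| <= 4.
    apply: (@leq_trans (\sum_(i in (S :\ j) :\ col x y) 2)).
      by apply: leq_sum => i /setD1P[_]; apply: sup_le'.
    by rewrite sum_nat_const; have := cardsD1 (col x y) (S :\ j);
      rewrite cS S'3 add1n => -[<-].
  by move=> h; rewrite -(leq_add2r 4); apply: leq_trans h _; rewrite leq_add2l.
(* The total is at most six, and each of the at least five other vertices contributes one or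
   more. *)
have priv_le v : v \in W -> #|priv v| <= 1.
  move=> vW; rewrite -(leq_add2r 5).
  have le6 : \sum_(v in W) #|priv v| <= 6.
    rewrite sum_S'; apply: (@leq_trans (\sum_(i in S :\ j) 2)).
      by apply: leq_sum.
    by rewrite sum_nat_const S'3.
  apply: leq_trans le6; rewrite (big_setD1 v) //= leq_add2l.
  apply: (@leq_trans (\sum_(u in W :\ v) 1)).
    rewrite sum1_card; have := cardsD1 v W; rewrite vW => e.
    by move: W_gt; rewrite e.
  by apply: leq_sum => u /setD1P[_]; apply: priv_pos.
(* Two edges at [v] of colors other than [j] have colors private to [v], hence the same color. Its
   [sup] is the pair of endpoints of either edge, so the edges coincide: the colors other than [j]
   form a matching. *)
apply: (@mono_paw_near_complete W j W_gt) => v vW.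
apply/card_le1P => u; rewrite inE => /and3P[uW uv uj] w; rewrite !inE.
apply/and3P/eqP=> [[wW wv wj]|-> //].
have vu : v != u by rewrite eq_sym.
have vw : v != w by rewrite eq_sym.
have pu : col v u \in priv v.
  have : v \in sup (col v u) by rewrite sup_eq // set21.
  by rewrite inE => /andP[].
have pw : col v w \in priv v.
  have : v \in sup (col v w) by rewrite sup_eq // set21.
  by rewrite inE => /andP[].
have /card_le1_eqP/(_ _ _ pu pw) e := priv_le v vW.
have : w \in sup (col v u) by rewrite -e sup_eq // set22.
by rewrite sup_eq // in_set2 (negPf wv) => /eqP.
Qed.

Lemma five_vertices (W : {set V}) : 4 < #|W| -> 3 < #|colors_on W| ->
  exists2 W' : {set V}, #|W'| = 5 & 3 < #|colors_on W'|.
Proof.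
elim: {W}#|W| {-2}W (erefl #|W|) => [W -> //|m IHm W cardW W_gt S_gt].
have [W5|W_gt5] := leqP #|W| 5; first exists W => //.
  by apply/eqP; rewrite eqn_leq W5.
have [v vW v_gt] := drop_vertex W_gt5 S_gt.
have cardWv : #|W :\ v| = m by have := cardsD1 v W; rewrite vW cardW => -[].
by apply: IHm v_gt => //; rewrite cardWv -ltnS -cardW.
Qed.

(** * Transfer to the exhaustive search *)

Hypothesis path_free : rainbow_P5_free col.

Lemma good_coloring_seq (s : seq V) n r : size s = n -> uniq s ->
  edge_index_valid n -> 5 <= n -> r <= #|colors_on [set x in take 5 s]| ->
  ~~ no_good_coloring n r.
Proof.
move=> size_s s_uniq valid n_ge r_le.
have [x0 _] : exists x0 : V, true.
  by case: s size_s n_ge {s_uniq r_le} => [<-|x] //; exists x.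
pose f := nth x0 s.
have f_uniq p : all (fun u => u < n) p -> uniq p -> uniq (map f p).
  move=> /allP p_lt; rewrite map_inj_in_uniq // => u v /p_lt u_lt /p_lt v_lt /eqP.
  by rewrite nth_uniq ?size_s // => /eqP.
apply: (@good_coloring_search _ (col x0 x0) n r (fun u v => col (f u) (f v))) => //.
- move=> p p_lt p_uniq p_size; rewrite -path_colors_map; apply: path_free.
    exact: f_uniq.
  by rewrite size_map.
- by move=> x y z w /f_uniq h /h; apply: paw_free.
apply: leq_trans r_le _; rewrite cardE; apply: uniq_leq_size (enum_uniq _) _ => i.
rewrite mem_enum mem_undup => /colors_onP[x [y [xs ys xy ->]]].
rewrite inE in xs; rewrite inE in ys.
have size5 : size (take 5 s) = 5 by rewrite size_takel ?size_s.
(* [edge_list] holds each pair with the smaller vertex first. *)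
wlog lt : x y xs ys xy / index x (take 5 s) < index y (take 5 s).
  move=> wl; case: (ltngtP (index x (take 5 s)) (index y (take 5 s))) => [||e].
  - exact: wl.
  - by rewrite col_sym; apply: wl; rewrite // eq_sym.
  - by case/eqP: xy; rewrite -(nth_index x0 xs) e nth_index.
have idx_lt z : z \in take 5 s -> index z (take 5 s) < 5.
  by rewrite -index_mem size5.
have fE z : z \in take 5 s -> f (index z (take 5 s)) = z.
  by move=> zs; rewrite /f -(@nth_take 5) ?nth_index ?idx_lt.
apply/mapP; exists (index x (take 5 s), index y (take 5 s)).
  apply/allpairsPdep; exists (index y (take 5 s)), (index x (take 5 s)).
  by rewrite !mem_iota add0n lt idx_lt.
by rewrite /= !fE.
Qed.

(** Take five vertices spanning at least four colors. The search on six vertices excludes a sixth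
    vertex, so these five are all; the search on five then excludes a fifth color. *)
Lemma few_colors : 4 < #|V| -> 3 < #|colors_on setT| ->
  #|V| = 5 /\ #|colors_on setT| = 4.
Proof.
move=> V_gt S_gt.
have [W W5 W_gt] : exists2 W : {set V}, #|W| = 5 & 3 < #|colors_on W|.
  by apply: five_vertices S_gt; rewrite cardsT.
have takeW s : [set x in take 5 (enum W ++ s)] = W.
  by rewrite take_size_cat -?cardE //; apply/setP=> x; rewrite inE mem_enum.
have V5 : #|V| = 5.
  apply/eqP; rewrite eqn_leq V_gt andbT leqNgt; apply/negP=> V_gt5.
  have [x _ xW] : exists2 x, x \in [set: V] & x \notin W.
    by apply: exists_in_setD; rewrite cardsT W5.
  suff: ~~ no_good_coloring 6 4 by rewrite no_good_coloring6.
  (* The extra vertex comes last, since the color requirement concerns the first five entries. *)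
  apply: (@good_coloring_seq (enum W ++ [:: x]) 6 4 _ _ isT isT).
  - by rewrite size_cat -cardE W5.
  - by rewrite cat_uniq enum_uniq /= mem_enum orbF xW.
  - by rewrite takeW.
split=> //; apply/eqP; rewrite eqn_leq S_gt andbT leqNgt; apply/negP=> S_gt4.
have WT : W = [set: V] by apply/eqP; rewrite eqEcard subsetT cardsT V5 W5.
suff: ~~ no_good_coloring 5 5 by rewrite no_good_coloring5.
apply: (@good_coloring_seq (enum W) 5 5 _ _ isT isT).
- by rewrite -cardE W5.
- exact: enum_uniq.
- by rewrite -(cats0 (enum W)) takeW WT.
Qed.

End ManyColors.

(** * Three colors *)

Lemma pigeonhole_set (V C : finType) (g : V -> C) (X : {set V}) (D : {set C}) m :
  {in X, forall x, g x \in D} -> m * #|D| < #|X| ->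
  exists2 i, i \in D & m < #|[set x in X | g x == i]|.
Proof.
move=> gD; case: (boolP [exists i in D, m < #|[set x in X | g x == i]|]).
  by move=> /exists_inP.
rewrite negb_exists_in => /forall_inP few; rewrite ltnNge => /negP[].
rewrite -sum1_card (partition_big g (mem D)) //= mulnC -sum_nat_const.
by apply: leq_sum => i /few; rewrite -leqNgt sum1dep_card.
Qed.

Section ThreeColors.

Variables (V : finType) (col : V -> V -> 'I_3).
Hypothesis paw_free : mono_paw_free col.

Lemma third_color (i l a b : 'I_3) :
  i != l -> a != i -> a != l -> b != i -> b != l -> a = b.
Proof.
move=> il ai al bi bl; apply/val_inj; move: il ai al bi bl; rewrite -!val_eqE.
case: i => [[|[|[|i]]] ?] //; case: l => [[|[|[|l]]] ?] //;
case: a => [[|[|[|a]]] ?] //; by case: b => [[|[|[|b]]] ?].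
Qed.

(** An edge [y z] of color [i] would close a monochromatic triangle with [x], and a third vertex [w]
    of [A] would supply the pendent edge [x w]. *)
Lemma neighbors_avoid (A : {set V}) x i : 2 < #|A| -> x \notin A ->
  {in A, forall y, col x y = i} -> {in A &, forall y z, y != z -> col y z != i}.
Proof.
move=> A_gt xA xAi y z yA zA yz; apply/eqP=> yzi.
have [|w wA] := @exists_in_setD _ A [set y; z]; first by rewrite cards2 yz.
rewrite !inE negb_or => /andP[wy wz].
have neq_x u : u \in A -> x != u by apply: contraTneq => <-.
apply: (@paw_freeP _ _ _ paw_free x y z w i); rewrite ?xAi //=.
by rewrite !inE !negb_or !neq_x // yz ![_ == w]eq_sym wy wz.
Qed.

(** The argument for R(3, 3) = 6: a vertex is joined to at least five others in two colors, so three
    of them share a color [j]. Among themselves these three avoid [i] and [j], so they span a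
    triangle in the third color. *)
Lemma mono_triangle (X : {set V}) i : 5 < #|X| ->
  {in X &, forall y z, y != z -> col y z != i} ->
  exists x y z, [/\ [/\ x \in X, y \in X & z \in X], uniq [:: x; y; z],
    col x y = col x z & col x y = col y z].
Proof.
move=> X_gt Xi.
have [x xX _] : exists2 x, x \in X & x \notin set0.
  by apply: exists_in_setD; rewrite cards0 (leq_trans _ X_gt).
have [||j ji A_gt] := @pigeonhole_set _ _ (col x) (X :\ x) [set~ i] 2.
- by move=> y /setD1P[yx yX]; rewrite !inE Xi // eq_sym.
- have := cardsC1 i; rewrite card_ord => ->.
  by have := cardsD1 x X; rewrite xX => e; rewrite e in X_gt.
set A := [set _ in _ | _] in A_gt.
have AX y : y \in A -> y \in X by rewrite !inE => /andP[/andP[]].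
have Aj : {in A &, forall y z, y != z -> col y z != j}.
  apply: (neighbors_avoid (x := x) A_gt); first by rewrite !inE eqxx.
  by move=> y; rewrite inE => /andP[_ /eqP].
have ij : i != j by move: ji; rewrite !inE eq_sym.
have Aeq u v u' v' : u \in A -> v \in A -> u' \in A -> v' \in A -> u != v ->
    u' != v' -> col u v = col u' v'.
  by move=> *; apply: (third_color ij); do ?[exact: Aj | apply: Xi => //; exact: AX].
case/card_gt2P: (A_gt) => y [z [w [[yA zA wA] [yz zw wy]]]].
exists y, z, w; split; first by rewrite !AX.
- by rewrite /= !inE negb_or yz zw eq_sym wy.
- by apply: Aeq; rewrite // eq_sym.
- exact: Aeq.
Qed.

Lemma triangle_isolated x y z w : uniq [:: x; y; z] -> w \notin [set x; y; z] ->
  col x y = col x z -> col x y = col y z -> col x w != col x y.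
Proof.
move=> xyz_uniq wxyz xz yz; apply/eqP=> xw.
apply: (@paw_freeP _ _ _ paw_free x y z w (col x y)) => //.
rewrite -cat1s -[_ ++ _]/(rcons [:: x; y; z] w) rcons_uniq xyz_uniq andbT.
by move: wxyz; rewrite !inE !negb_or -!andbA.
Qed.

(** With seven vertices there is a monochromatic triangle [x y z]. No further edge of its color
    leaves it, so [x] is joined to the at least four other vertices in the one remaining color. By
    [neighbors_avoid] these also avoid that color among themselves, and so contain a monochromatic
    complete graph on four vertices. *)
Lemma two_colors_small (X : {set V}) i :
  {in X &, forall y z, y != z -> col y z != i} -> #|X| <= 6.
Proof.
move=> Xi; rewrite leqNgt; apply/negP=> X_gt.
have [x [y [z [[xX yX zX] xyz xz yz]]]] := mono_triangle (ltnW X_gt) Xi.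
have xy : x != y by move: xyz; rewrite /= !inE negb_or => /andP[/andP[]].
pose A := X :\: [set x; y; z].
have A_gt : 3 < #|A|.
  rewrite -(leq_add2l 3); apply: leq_trans X_gt _.
  rewrite -(cardsID [set x; y; z] X) leq_add2r.
  apply: leq_trans (subset_leq_card (subsetIr _ _)) _.
  by rewrite cardsU cards1 cards2 xy leq_subr.
have AX w : w \in A -> w \in X by case/setDP.
have Axj w : w \in A -> col x w != col x y.
  by case/setDP=> _ wxyz; apply: triangle_isolated xz yz.
have Ax w : w \in A -> x != w.
  by case/setDP=> _; apply: contraNneq => <-; rewrite !inE eqxx.
case/card_gt2P: (ltnW A_gt) => a [b [c [[aA bA cA] [ab bc ca]]]].
have [|d dA] := @exists_in_setD _ A [set a; b; c].
  by apply: leq_ltn_trans A_gt; rewrite cardsU cards1 cards2 ab leq_subr.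
rewrite !inE !negb_or -andbA => /and3P[da db dc].
have Axi w : w \in A -> col x w != i.
  by move=> wA; apply: Xi => //; [exact: AX | exact: Ax].
have xai := Axi a aA.
have Al : {in A &, forall u v, u != v -> col u v != col x a}.
  apply: (neighbors_avoid (x := x)); first exact: ltnW.
    by apply/negP=> /Ax; rewrite eqxx.
  have ij : i != col x y by rewrite eq_sym Xi.
  by move=> u uA; apply: (third_color ij); rewrite ?Axi ?Axj.
have Aeq u v u' v' : u \in A -> v \in A -> u' \in A -> v' \in A -> u != v ->
    u' != v' -> col u v = col u' v'.
  move=> *; have ia : i != col x a by rewrite eq_sym.
  by apply: (third_color ia); do ?[exact: Al | apply: Xi => //; exact: AX].
have ac : a != c by rewrite eq_sym.
have ad : a != d by rewrite eq_sym.
apply: (@paw_freeP _ _ _ paw_free a b c d (col a b)) => //; try exact: Aeq.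
by rewrite /= !inE !negb_or ab bc ac ad [b == d]eq_sym [c == d]eq_sym db dc.
Qed.

(** With 17 vertices, [a] has six neighbors in one color, as 16 > 3 * 5, and they contain a
    monochromatic triangle. One of its vertices, [x], is joined to the at least 14 vertices outside
    in two colors, hence to seven of them in one color [l]. Those avoid [l] among themselves,
    against [two_colors_small]. *)
Lemma three_colors_small : #|V| <= 16.
Proof.
rewrite leqNgt; apply/negP=> V_gt.
have [a _ _] : exists2 x, x \in [set: V] & x \notin set0.
  by apply: exists_in_setD; rewrite cards0 cardsT (leq_trans _ V_gt).
have [//||i _ A_gt] := @pigeonhole_set _ _ (col a) (setT :\ a) [set: 'I_3] 5.
  rewrite cardsT card_ord; have := cardsD1 a [set: V]; rewrite cardsT inE => e.
  by rewrite e in V_gt.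
set A := [set _ in _ | _] in A_gt.
have Ai : {in A &, forall y z, y != z -> col y z != i}.
  apply: (neighbors_avoid (x := a)); first by rewrite (leq_trans _ A_gt).
    by rewrite !inE eqxx.
  by move=> y; rewrite inE => /andP[_ /eqP].
have [x [y [z [_ xyz xz yz]]]] := mono_triangle A_gt Ai.
have xNB w : w \notin [set x; y; z] -> x != w.
  by apply: contraNneq => <-; rewrite !inE eqxx.
have [||l lj B_gt] := @pigeonhole_set _ _ (col x) (~: [set x; y; z]) [set~ col x y] 6.
- by move=> w; rewrite inE => wxyz; rewrite !inE (triangle_isolated xyz wxyz).
- have := cardsC1 (col x y); rewrite card_ord => ->.
  rewrite cardsCs setCK ltn_subRL; apply: leq_ltn_trans (ltnW V_gt).
  apply: (@leq_add _ _ 3 12) => //; rewrite cardsU cards1 cards2.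
  by apply: leq_trans (leq_subr _ _) _; case: (x != y).
suff: #|[set w in ~: [set x; y; z] | col x w == l]| <= 6 by rewrite leqNgt B_gt.
apply: (two_colors_small (i := l)); apply: (neighbors_avoid (x := x)).
- by rewrite (leq_trans _ B_gt).
- by rewrite !inE eqxx.
- by move=> w; rewrite inE => /andP[_ /eqP].
Qed.

End ThreeColors.

(** * From colorings of complete graphs to forcing *)

Definition edge_color (k n : nat) (c : {set complete_graph n} -> 'I_k)
  (x y : 'I_n) : 'I_k := c [set x; y].

Lemma edge_color_sym k n (c : {set complete_graph n} -> 'I_k) x y :
  edge_color c x y = edge_color c y x.
Proof. by rewrite /edge_color setUC. Qed.

Lemma copy_edgesP (H : sgraph) (V : finType) (f : H -> V) (e : {set V}) :
  reflect (exists x y, adj x y /\ e = [set f x; f y])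
          (e \in [set f @: d | d : {set H} in edges H]).
Proof.
have imset2 (x y : H) : f @: [set x; y] = [set f x; f y].
  by rewrite imsetU !imset_set1.
apply: (iffP imsetP) => [[d /imsetP[[x y]]]|[x [y [xy ->]]]].
  by rewrite inE /= => xy -> ->; exists x, y; rewrite imset2.
exists [set x; y]; last by rewrite imset2.
by apply/imsetP; exists (x, y); rewrite ?inE.
Qed.

(** The edges are listed in path order, so that mapping a coloring over the list is convertible to
    [path_colors]. *)
Lemma mem_path_edges (V : finType) (f : path_graph 5 -> V) (e : {set V}) :
  let g m := f (inord m) in
  (e \in [set f @: d | d : {set path_graph 5} in edges (path_graph 5)])
  = (e \in [:: [set g 0; g 1]; [set g 1; g 2]; [set g 2; g 3]; [set g 3; g 4]]).
Proof.
move=> g; apply/copy_edgesP/idP => [[x [y [xy ->]]]|].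
  have -> : f x = g x by rewrite /g inord_val.
  have -> : f y = g y by rewrite /g inord_val.
  wlog xy1 : x y {xy} / x.+1 = y :> nat.
    move=> wl; case/andP: xy => _ /orP[/eqP|/eqP] h; first exact: wl.
    by rewrite setUC; apply: wl.
  have := ltn_ord y; rewrite -xy1.
  by case: (nat_of_ord x) => [|[|[|[|m]]]] //; rewrite !inE eqxx ?orbT.
have adjS m : m < 4 -> adj (inord m : path_graph 5) (inord m.+1).
  by move=> m_lt; rewrite /= /sym_adj -val_eqE /= !inordK ?(leqW m_lt) //
    eqxx andbT ltn_eqF.
rewrite !inE => /or4P[]/eqP->.
- by exists (inord 0), (inord 1); split; first exact: adjS.
- by exists (inord 1), (inord 2); split; first exact: adjS.
- by exists (inord 2), (inord 3); split; first exact: adjS.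
- by exists (inord 3), (inord 4); split; first exact: adjS.
Qed.

Lemma mem_paw_edges (V : finType) (f : star_plus 4 1 -> V) (e : {set V}) :
  let g m := f (inord m) in
  (e \in [set f @: d | d : {set star_plus 4 1} in edges (star_plus 4 1)])
  = (e \in [:: [set g 0; g 1]; [set g 0; g 2]; [set g 1; g 2]; [set g 0; g 3]]).
Proof.
move=> g; apply/copy_edgesP/idP => [[x [y [xy ->]]]|].
  have -> : f x = g x by rewrite /g inord_val.
  have -> : f y = g y by rewrite /g inord_val.
  move: xy; rewrite /= /sym_adj -val_eqE /=; have := ltn_ord x; have := ltn_ord y.
  case: (nat_of_ord x) => [|[|[|[|m]]]] //;
    case: (nat_of_ord y) => [|[|[|[|m']]]] // _ _ // _;
    by [rewrite !inE eqxx ?orbT | rewrite [X in X \in _]setUC !inE eqxx ?orbT].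
rewrite !inE => /or4P[]/eqP->.
- by exists (inord 0), (inord 1); split; rewrite // /= /sym_adj -val_eqE /= !inordK.
- by exists (inord 0), (inord 2); split; rewrite // /= /sym_adj -val_eqE /= !inordK.
- by exists (inord 1), (inord 2); split; rewrite // /= /sym_adj -val_eqE /= !inordK.
- by exists (inord 0), (inord 3); split; rewrite // /= /sym_adj -val_eqE /= !inordK.
Qed.

Lemma set2_neq (V : finType) (a b c d : V) :
  a != c -> a != d -> [set a; b] != [set c; d].
Proof.
move=> ac ad; apply: contraTneq (set21 a b) => ->.
by rewrite in_set2 negb_or ac ad.
Qed.

Lemma rainbow_P5P k n (c : {set complete_graph n} -> 'I_k) :
  (exists2 F, is_copy (path_graph 5) F & rainbow c F) <->
  exists p, [/\ uniq p, size p = 5 & uniq (path_colors (edge_color c) p)].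
Proof.
split=> [[F [f [f_inj _ ->]] F_rainbow]|[p [p_uniq p_size c_uniq]]].
  pose g m := f (inord m); exists [seq g m | m <- iota 0 5].
  have p_uniq : uniq [seq g m | m <- iota 0 5].
    rewrite map_inj_in_uniq ?iota_uniq // => u v; rewrite !mem_iota => u_lt v_lt.
    by move/f_inj/(congr1 val); rewrite /= !inordK.
  split=> //; rewrite -[path_colors _ _]/[seq c e | e <- [:: [set g 0; g 1];
    [set g 1; g 2]; [set g 2; g 3]; [set g 3; g 4]]].
  (* Injectivity of [c] on the edges yields distinct colors once the four edges are known to be
     distinct sets; this follows from the distinctness of the vertices. *)
  rewrite map_inj_in_uniq; last first.
    by move=> e e'; rewrite -!mem_path_edges; apply: F_rainbow.
  move: p_uniq => /=; rewrite !inE !negb_or.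
  case/and5P=> /and4P[? ? ? ?] /and3P[? ? ?] /andP[? ?] ? _.
  by rewrite !set2_neq.
case: p p_size p_uniq c_uniq => [|x0 [|x1 [|x2 [|x3 [|x4 []]]]]] // _ p_uniq c_uniq.
pose f (i : path_graph 5) : complete_graph n := nth x0 [:: x0; x1; x2; x3; x4] i.
have f_inj : injective f.
  by move=> i j /eqP; rewrite nth_uniq // => /eqP; apply: val_inj.
exists [set f @: d | d : {set path_graph 5} in edges (path_graph 5)].
  exists f; split=> // x y /andP[xy _].
  by rewrite /= /sym_adj (inj_eq f_inj) xy.
move=> e e'; rewrite !mem_path_edges => se se' ee'.
move: se se'; set s := [:: _; _; _; _] => se se'.
have {}c_uniq : uniq [seq c e | e <- s] by rewrite /s /f !inordK.
(* The list of colors has no repetition, so edges of equal color stand at the same place in [s]. *)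
rewrite -(nth_index e se) -(nth_index e se'); congr nth; apply/eqP.
rewrite -(nth_uniq (c e) _ _ c_uniq) ?size_map ?index_mem //.
by rewrite !(nth_map e) ?index_mem // !nth_index ?ee'.
Qed.

Lemma mono_pawP k n (c : {set complete_graph n} -> 'I_k) :
  (exists2 F, is_copy (star_plus 4 1) F & monochromatic c F) <->
  exists x y z w, uniq [:: x; y; z; w] /\
    constant (paw_colors (edge_color c) x y z w).
Proof.
split=> [[F [f [f_inj _ ->]] [i F_mono]]|[x [y [z [w [p_uniq c_const]]]]]].
  pose g m := f (inord m); exists (g 0), (g 1), (g 2), (g 3); split.
    rewrite -[[:: _; _; _; _]]/[seq g m | m <- iota 0 4].
    rewrite map_inj_in_uniq ?iota_uniq // => u v; rewrite !mem_iota => u_lt v_lt.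
    by move/f_inj/(congr1 val); rewrite /= !inordK.
  apply: (@all_pred1_constant _ i); apply/allP=> j.
  rewrite -[paw_colors _ _ _ _ _]/[seq c e | e <- [:: [set g 0; g 1];
    [set g 0; g 2]; [set g 1; g 2]; [set g 0; g 3]]].
  by case/mapP=> e; rewrite -mem_paw_edges => /F_mono ce ->; rewrite /= ce.
pose f (i : star_plus 4 1) : complete_graph n := nth x [:: x; y; z; w] i.
have f_inj : injective f.
  by move=> i j /eqP; rewrite nth_uniq // => /eqP; apply: val_inj.
exists [set f @: d | d : {set star_plus 4 1} in edges (star_plus 4 1)].
  exists f; split=> // u v /andP[uv _].
  by rewrite /= /sym_adj (inj_eq f_inj) uv.
exists (edge_color c x y) => e; rewrite mem_paw_edges /f !inordK //=.
move: c_const; rewrite /= andbT => /and3P[/eqP xz /eqP yz /eqP xw].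
by rewrite !inE => /or4P[]/eqP->.
Qed.

Lemma forcesP k n : forces k (path_graph 5) (star_plus 4 1) n <->
  forall c : {set complete_graph n} -> 'I_k, exact_coloring c ->
    rainbow_P5_free (edge_color c) -> mono_paw_free (edge_color c) -> False.
Proof.
split=> forced c c_exact.
  move=> path_free paw_free; case: (forced c c_exact).
    by case/rainbow_P5P=> p [/path_free h /h /negPf ->].
  by case/mono_pawP=> x [y [z [w [/paw_free /negPf ->]]]].
(* The candidate vertex sequences are tuples over a finite type, so boolean quantifiers decide
   between the two alternatives without classical axioms. *)
case: (boolP [exists p : 5.-tuple 'I_n,
    uniq p && uniq (path_colors (edge_color c) p)]).
  case/existsP=> p /andP[p_uniq c_uniq]; left; apply/rainbow_P5P; exists p.
  by rewrite size_tuple.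
move=> /existsPn path_free; right; apply/mono_pawP.
case: (boolP [exists p : 4.-tuple 'I_n, uniq p && (if val p is [:: x; y; z; w]
    then constant (paw_colors (edge_color c) x y z w) else false)]).
  case/existsP=> -[[|x [|y [|z [|w []]]]] //= _] /andP[p_uniq c_const].
  by exists x, y, z, w.
move=> /existsPn paw_free; exfalso; apply: (forced c c_exact).
  move=> p p_uniq /eqP p_size; have := path_free (Tuple p_size).
  by rewrite negb_and p_uniq.
move=> x y z w p_uniq; have := paw_free [tuple x; y; z; w].
by rewrite negb_and p_uniq.
Qed.

Lemma forces3 n : 17 <= n -> forces 3 (path_graph 5) (star_plus 4 1) n.
Proof.
move=> n_ge; apply/forcesP => c _ _ paw_free.
have := three_colors_small paw_free.
by rewrite card_ord leqNgt n_ge.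
Qed.

(** Given the two bounds, the last hypothesis excludes only [n = 5], [k = 4], the pair left open by
    [few_colors]. *)
Lemma forces_ge4 k n : 4 <= k -> 5 <= n -> (5 < n) || (4 < k) ->
  forces k (path_graph 5) (star_plus 4 1) n.
Proof.
move=> k_ge n_ge kn; apply/forcesP => c c_exact path_free paw_free.
have all_colors : colors_on (edge_color c) setT = setT.
  apply/setP=> i; rewrite inE; apply/colors_onP.
  have [e /imsetP[[x y]]] := c_exact i.
  by rewrite inE => /andP[xy _] -> <-; exists x, y; rewrite !inE.
have := @few_colors _ _ _ (edge_color_sym c) paw_free path_free.
rewrite all_colors cardsT !card_ord => /(_ n_ge k_ge)[n5 k4].
by rewrite n5 k4 in kn.
Qed.

(** * Lower bounds *)

Section Table.

Variables (k n : nat) (g : nat -> nat -> nat).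

Definition table_wf : bool :=
  all (fun x => (g x x == 0) &&
    all (fun y => (g x y == g y x) && (g x y <= k)) (iota 0 n)) (iota 0 n).

Definition table_exact : bool :=
  all (fun i => has (fun x => has (fun y => (x != y) && (g x y == i))
    (iota 0 n)) (iota 0 n)) (iota 0 k.+1).

(** Every paw contains a triangle, so this stronger property excludes monochromatic paws by a
    shorter enumeration. *)
Definition table_triangle_free : bool :=
  all (fun p => if p is [:: x; y; z]
    then ~~ ((g x y == g x z) && (g x y == g y z))
                else false) (injective_seqs n 3).

(** For [k < 3] the at most three colors cannot make a path with four edges rainbow; for [n = 16]
    the shortcut avoids enumerating more than half a million sequences. *)
Definition table_rainbow_free : bool :=
  if k < 3 then true else
  all (fun p => ~~ uniq (path_colors g p)) (injective_seqs n 5).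

(** Colorings act on unordered sets, so the table is read through a maximum. On [[set x; y]] it
    equals [g x y] when [g] is symmetric with zero diagonal, as [table_wf] demands. *)
Definition table_coloring (e : {set complete_graph n}) : 'I_k.+1 :=
  inord (\max_(x in e) \max_(y in e) g x y).

Hypothesis wf : table_wf.

Lemma table_coloringE (x y : 'I_n) : x != y ->
  edge_color table_coloring x y = g x y :> nat.
Proof.
move=> xy; have mem (z : 'I_n) : val z \in iota 0 n by rewrite mem_iota ltn_ord.
have /andP[/eqP gxx /allP/(_ _ (mem y))/andP[/eqP gxy g_le]] := allP wf _ (mem x).
have /andP[/eqP gyy _] := allP wf _ (mem y).
have max2 (F : 'I_n -> nat) : \max_(z in [set x; y]) F z = maxn (F x) (F y).
  by rewrite big_setU1 ?inE //= big_set1.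
by rewrite /edge_color /table_coloring !max2 gxx gyy -gxy max0n maxn0 maxnn inordK.
Qed.

Lemma table_not_forces : table_exact -> table_triangle_free ->
  table_rainbow_free -> ~ forces k.+1 (path_graph 5) (star_plus 4 1) n.
Proof.
move=> exact_g triangle_free_g rainbow_free_g /forcesP /(_ table_coloring).
apply.
- move=> i; have /allP/(_ (val i)) := exact_g.
  rewrite mem_iota ltn_ord => /(_ isT)/hasP[x + /hasP[y]].
  rewrite !mem_iota => /= x_lt y_lt /andP[xy /eqP gi].
  exists [set Ordinal x_lt; Ordinal y_lt].
    by apply/imsetP; exists (Ordinal x_lt, Ordinal y_lt) => //;
       rewrite inE /= /sym_adj -val_eqE /= xy.
  apply: val_inj; rewrite /= -gi.
  exact: (@table_coloringE (Ordinal x_lt) (Ordinal y_lt)).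
- move=> p p_uniq p_size; apply/negP=> c_uniq.
  move: rainbow_free_g; rewrite /table_rainbow_free; case: ltnP => [k_lt _|_].
    have := card_uniqP c_uniq.
    have := max_card (mem (path_colors (edge_color table_coloring) p)).
    rewrite card_ord => + e; rewrite e.
    case: p p_size {p_uniq c_uniq e} => [|a [|b [|c [|d [|f []]]]]] //= _.
    by rewrite leqNgt ltnS k_lt.
  move/allP/(_ [seq val x | x <- p]); rewrite mem_injective_seqs.
  rewrite (map_inj_uniq val_inj) p_uniq size_map p_size all_map /=.
  have -> : all (preim val (fun x => x < n)) p by apply/allP=> x _ /=.
  move=> /(_ isT)/negP[]; rewrite -(map_inj_uniq val_inj) in c_uniq.
  move: p_uniq p_size c_uniq; case: p => [|a [|b [|c [|d [|f []]]]]] //.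
  rewrite [in X in X -> _]/= !inE !negb_or.
  case/and5P=> /and4P[ab _ _ _] /and3P[bc _ _] /andP[cd _] df _ _.
  by rewrite [map _ _]/= !table_coloringE.
move=> x y z w xyzw; apply/negP=> /and4P[/eqP xz /eqP yz _ _].
have /allP/(_ [:: val x; val y; val z]) := triangle_free_g.
rewrite mem_injective_seqs -[[:: val x; _; _]]/[seq val u | u <- [:: x; y; z]].
have xyz : uniq [:: x; y; z].
  by move: xyzw; rewrite -[[:: x; y; z; w]]/(rcons [:: x; y; z] w) rcons_uniq => /andP[].
rewrite (map_inj_uniq val_inj) xyz size_map all_map /= !ltn_ord => /(_ isT).
move: xyz; rewrite /= !inE negb_or andbT => /andP[/andP[xy nxz] nyz].
by rewrite -!table_coloringE // xz yz eqxx.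
Qed.

End Table.

(** * Explicit colorings for the lower bounds *)

Definition matrix_table (M : seq (seq nat)) (x y : nat) : nat :=
  nth 0 (nth [::] M x) y.

(* Vertices are the elements of GF(16) = F_2[t]/(t^4 + t + 1), coded in binary;
   the color of x, y is the coset of x + y modulo the nonzero cubes. No coset
   contains a solution of u + v = w, so there is no monochromatic triangle. *)
Definition cubic_residue_table (x y : nat) : nat :=
  nth 0 [:: 0; 0; 1; 1; 2; 2; 2; 1; 0; 2; 0; 1; 0; 1; 2; 0] (Nat.lxor x y).

Lemma not_forces3 : ~ forces 3 (path_graph 5) (star_plus 4 1) 16.
Proof. by apply: (@table_not_forces 2 16 cubic_residue_table); vm_compute. Qed.

(** The three perfect matchings on the vertices 0, 1, 2, 3 receive three colors, vertex 4 is a twin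
    of vertex 3, and the edge between the twins receives the fourth color. *)
Lemma not_forces4 : ~ forces 4 (path_graph 5) (star_plus 4 1) 5.
Proof.
apply: (@table_not_forces 3 5 (matrix_table
  [:: [:: 0; 2; 1; 0; 0]; [:: 2; 0; 0; 1; 1]; [:: 1; 0; 0; 2; 2];
      [:: 0; 1; 2; 0; 3]; [:: 0; 1; 2; 3; 0]])); by vm_compute.
Qed.

(** Four vertices hold no path on five vertices. The edges from 3 to 1 and 2 share a color, and all
    other edges have colors of their own. *)
Lemma not_forces5 : ~ forces 5 (path_graph 5) (star_plus 4 1) 4.
Proof.
apply: (@table_not_forces 4 4 (matrix_table
  [:: [:: 0; 0; 1; 3]; [:: 0; 0; 2; 4]; [:: 1; 2; 0; 4]; [:: 3; 4; 4; 0]]));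
by vm_compute.
Qed.

Lemma not_forces6 : ~ forces 6 (path_graph 5) (star_plus 4 1) 4.
Proof.
apply: (@table_not_forces 5 4 (matrix_table
  [:: [:: 0; 0; 1; 3]; [:: 0; 0; 2; 4]; [:: 1; 2; 0; 5]; [:: 3; 4; 5; 0]]));
by vm_compute.
Qed.

(** A bound [M] forces every order from [M] on, so failure at the single order [N] rules out all
    [M <= N]. *)
Lemma gallai_ramsey_of_forces k (G H : sgraph) N : k <= 'C(N.+1, 2) ->
  (forall n, N < n -> forces k G H n) -> ~ forces k G H N ->
  is_gallai_ramsey k G H N.+1.
Proof.
move=> k_le upper lower; split=> // M [_ M_forces].
by rewrite ltnNge; apply/negP=> /M_forces.
Qed.

Theorem theorem3p6 (k : nat) (hk : 3 <= k) :
  [/\ k = 3 -> is_gallai_ramsey k (path_graph 5) (star_plus 4 1) 17,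
      k = 4 -> is_gallai_ramsey k (path_graph 5) (star_plus 4 1) 6,
      k = 5 \/ k = 6 -> is_gallai_ramsey k (path_graph 5) (star_plus 4 1) 5
    & forall l : nat, 5 <= l -> 'C(l - 1, 2) + 1 <= k <= 'C(l, 2) ->
        is_gallai_ramsey k (path_graph 5) (star_plus 4 1) l].
Proof.
split=> [->|->|k56|l l_ge /andP[k_gt k_le]].
- by apply: gallai_ramsey_of_forces not_forces3 => // n; apply: forces3.
- apply: gallai_ramsey_of_forces not_forces4 => // n n_gt.
  by apply: forces_ge4; rewrite ?n_gt // ltnW.
- case: k56 => ->.
    by apply: gallai_ramsey_of_forces not_forces5 => // n n_gt;
    apply: forces_ge4; rewrite ?orbT.
  by apply: gallai_ramsey_of_forces not_forces6 => // n n_gt;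
    apply: forces_ge4; rewrite ?orbT.
case: l => // l in l_ge k_gt k_le *; rewrite subn1 addn1 /= ltnS in l_ge k_gt.
(* After the shift of [l] by one, [k] exceeds ['C(l, 2)], which is at least ['C(4, 2) = 6]. *)
have k_ge : 4 < k.
  by apply: leq_ltn_trans k_gt; apply: leq_trans (leq_bin2l 2 l_ge).
split.
  split=> [|n n_gt]; first exact: k_le.
  have n_ge : 4 < n by apply: leq_ltn_trans n_gt.
  by apply: (forces_ge4 (ltnW k_ge) n_ge); rewrite k_ge orbT.
(* Here minimality comes from counting edges: for [M <= l] the complete graph has at most
   ['C(l, 2) < k] edges, too few for [k] colors. *)
move=> M [k_leM _]; rewrite ltnNge; apply/negP=> M_le.
have := leq_trans k_gt k_leM; rewrite ltnNge => /negP[].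
exact: leq_bin2l.
Qed.
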